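(* Let $V$ be a $p|q$-dimensional superspace over $\mathcal A$ with basis $e_1,\dots,e_{p+q}$ ($e_1,\dots,e_p$ even, $e_{p+1},\dots,e_{p+q}$ odd), let $A$ be an even invertible operator with matrix $(a_i{}^j)$ defined by $A(e_i)=\sum_j a_i{}^je_j$, and let $x=\sum_i x^ie_i$, $y=\sum_j y^je_j$ be vectors with $A(x)=y$, i.e. $y^j=\sum_i x^ia_i{}^j$. Let $A_k(y)$ denote the matrix obtained from $(a_i{}^j)$ by replacing its $k$-th row by $(y^1,\dots,y^{p+q})$. Then $$x^k=\frac{1}{\operatorname{Ber}A}\operatorname{Ber}A_k(y)\quad(k=1,\dots,p),\qquad x^k=\frac1{\operatorname{Ber}^*A}\operatorname{Ber}^*A_k(y)\quad(k=p+1,\dots,p+q).$$ Moreover, the entries of the inverse matrix are $$(A^{-1})_{ij}=\begin{cases}\dfrac{(\operatorname{adj}A)_{ji}}{\operatorname{Ber}A}&\text{when }j=1,\dots,p,\\[8pt] \dfrac{(\operatorname{adj}A)_{ji}}{\operatorname{Ber}^*A}&\text{when }j=p+1,\dots,p+q,\end{cases}$$ where $(\operatorname{adj}A)_{ij}=\operatorname{Ber}D_{ij}(A)$ for $i=1,\dots,p$ and $(\operatorname{adj}A)_{ij}=\operatorname{Ber}^*D_{ij}(A)$ for $i=p+1,\dots,p+q$, and $D_{ij}(A)$ is the matrix obtained from $A$ by replacing all elements of the $i$-th row by zeros except for the $j$-th element, which is replaced by $1$.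
   Context: Let $\mathcal A=\mathcal A_0\oplus\mathcal A_1$ be a $\mathbb Z_2$-graded supercommutative algebra over $\mathbb C$. A $p|q$-dimensional superspace $V$ means a free $\mathbb Z_2$-graded $\mathcal A$-module of rank $p|q$; scalars are written on the left of basis vectors. The matrix of an even operator consists of blocks $\begin{pmatrix} M_{00} & M_{01} \\ M_{10} & M_{11} \end{pmatrix}$ with the entries of $M_{00}$ ($p\times p$) and $M_{11}$ ($q\times q$) in $\mathcal A_0$ and those of $M_{01},M_{10}$ in $\mathcal A_1$. The Berezinian is $\operatorname{Ber}M=\det(M_{00}-M_{01}M_{11}^{-1}M_{10})\,(\det M_{11})^{-1}$, defined when $M_{11}$ is invertible. Regarded as a function of its rows, $\operatorname{Ber}$ is (left) linear in each of the first $p$ rows, and it is extended by linearity, by the same formula, to matrices in which one of the first $p$ rows is an arbitrary row of elements of $\mathcal A$ (not necessarily of the parity prescribed by the block structure). For a matrix $M$, $\operatorname{Ber}^*M:=\operatorname{Ber}M^{\Pi}$, where $M^\Pi=\begin{pmatrix} M_{11} & M_{10} \\ M_{01} & M_{00} \end{pmatrix}$ is the parity-reversed matrix of format $q|p$; correspondingly $\operatorname{Ber}^*$ extends by linearity to matrices in which one of the last $q$ rows is arbitrary. *)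

(* Defs.v *)
From HB Require Import structures.
From mathcomp Require Import all_boot all_order all_algebra.
From mathcomp Require Import boolp classical_sets reals complex.

Set Implicit Arguments.
Unset Strict Implicit.
Unset Printing Implicit Defensive.

Import GRing.Theory.

Local Open Scope classical_set_scope.
Local Open Scope ring_scope.

(* Z_2-gradings are indexed by bool: false is even, true is odd, and the sum  *)
(* of parities is addb, written (+).                                          *)

Definition direct_sum2 (M : zmodType) (G : bool -> {pred M}) : Prop :=
  forall m : M, exists! u : M * M,
    [/\ u.1 \in G false, u.2 \in G true & m = u.1 + u.2].

Record supercommutative_algebra (K : fieldType) (A : unitAlgType K)
    (G : bool -> {pred A}) : Prop := SupercommutativeAlgebra {
  sca_submod : forall b, GRing.submod_closed (G b);
  sca_direct : direct_sum2 G;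
  sca_one : 1 \in G false;
  sca_mul : forall b c (s t : A), s \in G b -> t \in G c -> s * t \in G (b (+) c);
  sca_comm : forall b c (s t : A), s \in G b -> t \in G c ->
    s * t = (-1) ^+ (b && c) * (t * s)
}.

Record graded_module (A : nzRingType) (G : bool -> {pred A})
    (V : lmodType A) (H : bool -> {pred V}) : Prop := GradedModule {
  gm_zmod : forall b, GRing.zmod_closed (H b);
  gm_direct : direct_sum2 H;
  gm_scale : forall b c (s : A) (v : V),
    s \in G b -> v \in H c -> s *: v \in H (b (+) c)
}.

Record homogeneous_basis (A : nzRingType) (p q : nat) (V : lmodType A)
    (H : bool -> {pred V}) (e : 'I_(p + q) -> V) : Prop := HomogeneousBasis {
  hb_even : forall i : 'I_p, e (lshift q i) \in H false;
  hb_odd : forall i : 'I_q, e (rshift p i) \in H true;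
  hb_coord : forall v : V,
    exists! x : 'rV[A]_(p + q), v = \sum_i x 0 i *: e i
}.

Definition even_operator (A : nzRingType) (V : lmodType A)
    (H : bool -> {pred V}) (F : {linear V -> V}) : Prop :=
  forall b (v : V), v \in H b -> F v \in H b.

(* The row convention: row i of a holds the coordinates of F (e i).           *)
Definition operator_matrix (A : nzRingType) (n : nat) (V : lmodType A)
    (e : 'I_n -> V) (F : {linear V -> V}) (a : 'M[A]_n) : Prop :=
  forall i, F (e i) = \sum_j a i j *: e j.

(* invmx needs commutative coefficients, hence an inverse by choice; it is    *)
(* unique when it exists, and the default value is M.                         *)
Definition mx_inverses (A : nzRingType) (n : nat) (M : 'M[A]_n) :
    set 'M[A]_n :=
  [set N | M *m N = 1%:M /\ N *m M = 1%:M].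

Definition mx_invertible (A : nzRingType) (n : nat) (M : 'M[A]_n) : Prop :=
  exists N, mx_inverses M N.

Definition mx_inv (A : nzRingType) (n : nat) (M : 'M[A]_n) : 'M[A]_n :=
  xget M (mx_inverses M).

(* Meaningful when the lower right block is invertible. The determinants are  *)
(* Leibniz sums over a noncommutative ring. For an even matrix all entries    *)
(* involved are even, hence central. If one of the first p rows of M is       *)
(* arbitrary, then so is one row of the first matrix below; every Leibniz     *)
(* term has a single factor from that row, so the order of the factors does   *)
(* not matter, and the formula is the left linear extension of Ber.           *)
Definition Ber (A : unitRingType) (p q : nat) (M : 'M[A]_(p + q)) : A :=
  \det (ulsubmx M - ursubmx M *m mx_inv (drsubmx M) *m dlsubmx M)
    * (\det (drsubmx M))^-1.

Definition parity_reversed (A : nzRingType) (p q : nat) (M : 'M[A]_(p + q)) :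
    'M[A]_(q + p) :=
  block_mx (drsubmx M) (dlsubmx M) (ursubmx M) (ulsubmx M).

Definition BerS (A : unitRingType) (p q : nat) (M : 'M[A]_(p + q)) : A :=
  Ber (parity_reversed M).

Definition replace_row (A : nzRingType) (n : nat) (k : 'I_n) (y : 'rV[A]_n)
    (M : 'M[A]_n) : 'M[A]_n :=
  \matrix_(i, j) (if i == k then y 0 j else M i j).

Definition Dmx (A : nzRingType) (n : nat) (i j : 'I_n) (M : 'M[A]_n) :
    'M[A]_n :=
  replace_row i (delta_mx 0 j) M.

Definition super_adj (A : unitRingType) (p q : nat) (M : 'M[A]_(p + q)) :
    'M[A]_(p + q) :=
  \matrix_(i, j) (if (i < p)%N then Ber (Dmx i j M) else BerS (Dmx i j M)).

(* Main.v *)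
(* Even elements are central and form a commutative ring, over which the      *)
(* usual determinant theory applies. If [M N = 1] then                        *)
(* [M00 N00 = 1 - M01 N10], and products of odd elements square to zero, so   *)
(* they lie in the Jacobson radical of the even ring: [M00], and likewise     *)
(* [M11], is invertible. If [y = x M], with [x = (x0, x1)] and [y = (y0, y1)] *)
(* split by format, eliminating [x1] gives [y0 - y1 M11^-1 M10 = x0 S] for    *)
(* the Schur complement [S = M00 - M01 M11^-1 M10]. Hence the first           *)
(* determinant in [Ber M_k(y)] is that of [S] with row [k] replaced by        *)
(* [x0 S], which is [x^k det S] by Cramer's rule; this survives for an        *)
(* arbitrary row [x0] because the entries of [S] are central. The odd case    *)
(* follows by parity reversal, and the inverse matrix by taking for [y] the   *)
(* basis rows.                                                                *)

Require Import Defs.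
From HB Require Import structures.
From mathcomp Require Import all_boot all_order all_algebra perm.
From mathcomp Require Import boolp classical_sets reals complex.

Set Implicit Arguments.
Unset Strict Implicit.
Unset Printing Implicit Defensive.

Import GRing.Theory.

Local Open Scope ring_scope.

(** Two translations surround the matrix computation. Uniqueness of homogeneous components shows
    that the matrix of a bijective even operator has an inverse that is again of even format
    ([operator_matrix_inverse]). Invertibility modulo the Jacobson radical of the even ring then
    makes the Schur complement invertible ([super_schur]), and Cramer's rule for that complement
    becomes [Ber_replace_row_mul]. Parity reversal carries the result to the odd rows
    ([parity_reversed_replace_row]), and [mx_inv_cramer] reads off the inverse by solving for its
    rows. *)

Lemma direct_sum2_decomp (M : zmodType) (G : bool -> {pred M}) (m : M) :
  direct_sum2 G ->
  exists2 u : bool -> M, forall b, u b \in G b & m = u false + u true.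
Proof.
move=> /(_ m) [[m0 m1]] [[/= m0G m1G ->] _].
by exists (fun b => if b then m1 else m0) => // -[].
Qed.

(** A homogeneous element is also decomposed with zero in the other degree; uniqueness of the
    decomposition does the rest. *)
Lemma direct_sum2_homogeneous (M : zmodType) (G : bool -> {pred M})
    (u : bool -> M) (c : bool) :
  (forall b, GRing.zmod_closed (G b)) -> direct_sum2 G ->
  (forall b, u b \in G b) -> u false + u true \in G c -> u (~~ c) = 0.
Proof.
move=> Gz dG uG sG.
have G0 b : 0 \in G b by case: (Gz b).
have [v [_ v_uniq]] := dG (u false + u true).
have vE : v = (u false, u true) by apply: v_uniq; split => /=.
case: c sG => sG /=.
  have: v = (0, u false + u true) by apply: v_uniq; split; rewrite /= ?add0r.
  by rewrite vE => -[].
have: v = (u false + u true, 0) by apply: v_uniq; split; rewrite /= ?addr0.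
by rewrite vE => -[].
Qed.

Section MatrixInverse.
Variables (A : nzRingType) (n : nat).
Implicit Types M N : 'M[A]_n.

Lemma mx_inverses_uniq M N1 N2 :
  M *m N1 = 1%:M -> N2 *m M = 1%:M -> N1 = N2.
Proof. by move=> MN1 N2M; rewrite -[N1]mul1mx -N2M -mulmxA MN1 mulmx1. Qed.

Lemma mx_inv_eq M N : M *m N = 1%:M -> N *m M = 1%:M -> mx_inv M = N.
Proof.
move=> MN NM; have [|MI _] := @xgetPex _ M (mx_inverses M); first by exists N.
exact: mx_inverses_uniq MI NM.
Qed.

End MatrixInverse.

Lemma mulmx1_blocks (A : nzRingType) p q (M N : 'M[A]_(p + q)) :
  M *m N = 1%:M ->
  [/\ ulsubmx M *m ulsubmx N + ursubmx M *m dlsubmx N = 1%:M,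
      dlsubmx M *m ulsubmx N + drsubmx M *m dlsubmx N = 0 &
      dlsubmx M *m ursubmx N + drsubmx M *m drsubmx N = 1%:M].
Proof.
rewrite -{1}[M]submxK -{1}[N]submxK mulmx_block scalar_mx_block.
by move=> /eq_block_mx[].
Qed.

(** * The even part as a commutative ring *)

Section EvenSubalgebra.
Variables (K : fieldType) (A : unitAlgType K) (G : bool -> {pred A}).
Hypothesis scaG : supercommutative_algebra G.

Lemma sca_zmod b : GRing.zmod_closed (G b).
Proof. exact/GRing.submod_closedB/(sca_submod scaG). Qed.

Lemma sca_sum b (I : Type) (r : seq I) (P : pred I) (F : I -> A) :
  (forall i, P i -> F i \in G b) -> \sum_(i <- r | P i) F i \in G b.
Proof.
have [G0 GD] := GRing.zmod_closedD (sca_zmod b).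
by move=> FG; elim/big_ind: _.
Qed.

Lemma sca_central (s t : A) : s \in G false -> s * t = t * s.
Proof.
move=> sG; have [u uG ->] := direct_sum2_decomp t (sca_direct scaG).
by rewrite mulrDr mulrDl !(sca_comm scaG sG (uG _)) /= !mul1r.
Qed.

Lemma sca_odd_sqr (s : A) : (2 != 0 :> K) -> s \in G true -> s * s = 0.
Proof.
move=> nz2 sG; have := sca_comm scaG sG sG; rewrite expr1 mulN1r => ss.
apply/eqP; have: (2 : K) *: (s * s) == 0.
  by rewrite scaler_nat mulr2n {1}ss addNr.
by rewrite scaler_eq0 (negPf nz2).
Qed.

(** The odd component of [t^-1], multiplied by the even unit [t], is the odd component of [1], hence
    zero; cancelling [t] shows that [t^-1] is even. *)
Lemma sca_divring : GRing.divring_closed (G false).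
Proof.
have [G0 GB] := sca_zmod false.
split=> // [|s t sG tG]; first exact: sca_one scaG.
apply: (sca_mul scaG (b := false) (c := false) sG).
(* By convention a non-unit is its own inverse, so that case is immediate. *)
have [Ut | /invr_out -> //] := boolP (t \is a GRing.unit).
have [u uG tV] := direct_sum2_decomp t^-1 (sca_direct scaG).
have tu b : t * u b \in G b by apply: (sca_mul scaG tG).
have /= tu0 := direct_sum2_homogeneous (c := false) sca_zmod
  (sca_direct scaG) tu.
have u0 : u true = 0.
  apply: (mulrI Ut); rewrite mulr0 tu0 //.
  by rewrite -mulrDr -tV divrr // (sca_one scaG).
by rewrite tV u0 addr0.
Qed.

End EvenSubalgebra.

(* Carrying the proof of supercommutativity in the type makes the commutative *)
(* ring structure below canonical.                                            *)
Definition even_pred (K : fieldType) (A : unitAlgType K)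
  (G : bool -> {pred A}) of supercommutative_algebra G : {pred A} := G false.

Section EvenRing.
Variables (K : fieldType) (A : unitAlgType K) (G : bool -> {pred A}).
Variable scaG : supercommutative_algebra G.

HB.instance Definition _ :=
  GRing.isDivringClosed.Build A (even_pred scaG) (sca_divring scaG).

Record even_ring :=
  EvenElement { even_val :> A; _ : even_val \in even_pred scaG }.

HB.instance Definition _ := [isSub for even_val].
HB.instance Definition _ := [Choice of even_ring by <:].
HB.instance Definition _ := [SubChoice_isSubUnitRing of even_ring by <:].

Fact even_ring_mulC : commutative (@GRing.mul even_ring).
Proof.
by move=> x y; apply: val_inj; rewrite !rmorphM /= (sca_central scaG) ?(valP x).
Qed.

HB.instance Definition _ :=
  GRing.PzRing_hasCommutativeMul.Build even_ring even_ring_mulC.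

Lemma even_valP (x : even_ring) : val x \in G false.
Proof. exact: valP x. Qed.

Lemma even_val_unit (x : even_ring) :
  (val x \is a GRing.unit) = (x \is a GRing.unit).
Proof. by []. Qed.

End EvenRing.

(** * Determinants modulo the Jacobson radical *)

Section JacobsonRadical.
Variable R : comUnitRingType.

(* In a commutative ring this describes the Jacobson radical; it is easier to *)
(* handle here than the nilradical.                                           *)
Definition quasiregular (x : R) := forall y, 1 + x * y \is a GRing.unit.

Lemma quasiregular0 : quasiregular 0.
Proof. by move=> y; rewrite mul0r addr0 unitr1. Qed.

Lemma quasiregularM x z : quasiregular x -> quasiregular (x * z).
Proof. by move=> Jx y; rewrite -mulrA. Qed.

Lemma quasiregularD x z :
  quasiregular x -> quasiregular z -> quasiregular (x + z).
Proof.
move=> Jx Jz y; set u := 1 + x * y.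
have Uu : u \is a GRing.unit by apply: Jx.
have -> : 1 + (x + z) * y = u * (1 + z * (y * u^-1)).
  rewrite mulrDr mulr1 !mulrA -(mulrC u^-1) !mulrA mulVr // mul1r.
  by rewrite mulrDl addrA.
by rewrite unitrM Uu Jz.
Qed.

Lemma quasiregular_sqr0 x : x * x = 0 -> quasiregular x.
Proof.
move=> xx y; apply/unitrPr; exists (1 - x * y).
by rewrite mulrC -subr_sqr expr1n expr2 mulrACA xx mul0r subr0.
Qed.

Lemma quasiregular_sum (I : Type) (r : seq I) (F : I -> R) :
  (forall i, quasiregular (F i)) -> quasiregular (\sum_(i <- r) F i).
Proof.
move=> JF; elim/big_ind: _ => //.
  exact: quasiregular0.
exact: quasiregularD.
Qed.

(** The matrix is congruent to the identity modulo the radical, so its determinant is congruent to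
    [1]. The two Leibniz sums are compared term by term, since congruence is stable under sums and
    products. *)
Lemma det_add1_unit n (Z : 'M[R]_n) :
  (forall i j, quasiregular (Z i j)) -> \det (1%:M + Z) \is a GRing.unit.
Proof.
move=> JZ.
suff Jd : quasiregular (\det (1%:M + Z) - \det (1%:M : 'M[R]_n)).
  by have := Jd 1; rewrite mulr1 det1 addrC subrK.
apply: (big_ind2 (fun x y => quasiregular (x - y))).
- by rewrite subrr; apply: quasiregular0.
- by move=> x1 x2 y1 y2 Jx Jy; rewrite opprD addrACA; apply: quasiregularD.
move=> s _; rewrite -mulrBr mulrC; apply: quasiregularM.
apply: (big_ind2 (fun x y => quasiregular (x - y))).
- by rewrite subrr; apply: quasiregular0.
- move=> x1 x2 y1 y2 Jx Jy.
  have -> : x1 * y1 - x2 * y2 = (x1 - x2) * y1 + (y1 - y2) * x2.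
    by rewrite !mulrBl [y1 * x2]mulrC [y2 * x2]mulrC addrA subrK.
  by apply: quasiregularD; apply: quasiregularM.
by move=> i _; rewrite !mxE addrAC subrr add0r.
Qed.

End JacobsonRadical.

(** * Matrices with homogeneous blocks *)

Section EvenMatrices.
Variables (K : fieldType) (A : unitAlgType K) (G : bool -> {pred A}).
Variable scaG : supercommutative_algebra G.
Hypothesis nz2 : 2 != 0 :> K.

Local Notation E := (even_ring scaG).
Local Notation emx := (map_mx (val : E -> A)).

Definition mx_parity b m n (M : 'M[A]_(m, n)) := forall i j, M i j \in G b.

Lemma even_mx_lift m n (M : 'M[A]_(m, n)) :
  mx_parity false M -> exists M0 : 'M[E]_(m, n), M = emx M0.
Proof.
move=> Mev.
exists (\matrix_(i, j) EvenElement (Mev i j : _ \in even_pred scaG)).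
by apply/matrixP=> i j; rewrite !mxE.
Qed.

Lemma mx_parityM b c m n r (M : 'M[A]_(m, n)) (N : 'M[A]_(n, r)) :
  mx_parity b M -> mx_parity c N -> mx_parity (b (+) c) (M *m N).
Proof.
move=> Mb Nc i j; rewrite mxE; apply: (sca_sum scaG) => k _.
exact: (sca_mul scaG).
Qed.

Lemma mx_parityB b m n (M N : 'M[A]_(m, n)) :
  mx_parity b M -> mx_parity b N -> mx_parity b (M - N).
Proof.
by move=> Mb Nb i j; rewrite !mxE; have [_] := sca_zmod scaG b; apply.
Qed.

(** Anticommuting the middle factors gives [s t s t = - s s t t], and odd squares vanish. *)
Lemma odd_mul_quasiregular (x : E) (s t : A) :
  s \in G true -> t \in G true -> val x = s * t -> quasiregular x.
Proof.
move=> sG tG xE; apply: quasiregular_sqr0; apply: val_inj.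
rewrite rmorphM rmorph0 /= [even_val x]xE mulrA -(mulrA s t s).
rewrite (sca_comm scaG tG sG) /= expr1 mulN1r mulrN.
by rewrite mulrA (sca_odd_sqr scaG nz2 sG) mul0r oppr0 mul0r.
Qed.

(** Here [P Q = 1 - B C], and the entries of [B C] are sums of products of odd elements, hence
    radical; so [\det P * \det Q] is a unit. With [P] a diagonal block of a matrix and [Q] that of
    its inverse, this inverts both diagonal blocks. *)
Lemma even_corner_unitmx m n (P Q : 'M[E]_n) (B : 'M[A]_(n, m))
    (C : 'M[A]_(m, n)) :
  mx_parity true B -> mx_parity true C -> emx P *m emx Q + B *m C = 1%:M ->
  P \in unitmx.
Proof.
move=> Bodd Codd PQ1; suff : \det (P *m Q) \is a GRing.unit.
  by rewrite det_mulmx unitrM => /andP[].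
have -> : P *m Q = 1%:M + (P *m Q - 1%:M) by rewrite addrC subrK.
apply: det_add1_unit => i j.
have zP k : - B i k * C k j \in even_pred scaG.
  apply: (sca_mul scaG (b := true) (c := true)) => //.
  exact: (GRing.zmod_closedN (sca_zmod scaG true)).
have -> : (P *m Q - 1%:M) i j = \sum_k (EvenElement (zP k)).
  apply: val_inj; rewrite [RHS]rmorph_sum.
  have /matrixP/(_ i j) := PQ1; rewrite -map_mxM !mxE => PQij.
  rewrite rmorphB rmorph_nat -PQij opprD addrA addrN add0r -sumrN.
  by apply: eq_bigr => k _; rewrite -mulNr.
apply: quasiregular_sum => k.
apply: (@odd_mul_quasiregular _ (- B i k) (C k j)) => //.
exact: (GRing.zmod_closedN (sca_zmod scaG true)).
Qed.

(** All factors but [z] are central, so [z], which may have any parity, moves to the front. *)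
Lemma prod_one_odd_factor (I : eqType) (r : seq I) (k : I) (z : A)
    (g : I -> E) :
  uniq r -> k \in r ->
  \prod_(i <- r) (if i == k then z else val (g i))
    = z * val (\prod_(i <- r) (if i == k then 1 else g i)).
Proof.
elim: r => [|i r IHr] //; rewrite cons_uniq => /andP[ir ur].
rewrite inE !big_cons [k == i]eq_sym.
have [ik _|ik kr] := eqVneq i k; last first.
  by rewrite IHr // rmorphM !mulrA (sca_central scaG z (even_valP _)).
rewrite mul1r rmorph_prod; congr (_ * _); apply: eq_big_seq => j jr.
by case: eqP jr ir => // ->; rewrite ik => ->.
Qed.

(** Left linearity in the replaced row. The coefficients are signed products of entries from the
    other rows; what matters later is that they are even and independent of [y]. *)
Lemma det_replace_row_even n (k : 'I_n) (S : 'M[E]_n) :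
  exists c : 'S_n -> E, forall y : 'rV[A]_n,
    \det (replace_row k y (emx S)) = \sum_(s : 'S_n) y 0 (s k) * val (c s).
Proof.
exists (fun s : 'S_n =>
  (-1) ^+ s * \prod_i (if i == k then 1 else S i (s i))) => y.
apply: eq_bigr => s _.
rewrite rmorphM mulrA -(sca_central scaG _ (even_valP ((-1) ^+ s))) rmorph_sign.
rewrite -mulrA; congr (_ * _).
rewrite -(@prod_one_odd_factor _ _ _ _ (fun i => S i (s i))).
- by apply: eq_bigr => i _; rewrite !mxE; case: eqP => // ->.
- exact: index_enum_uniq.
- exact: mem_index_enum.
Qed.

(** By linearity it suffices to replace row [k] by a row [i] of [S]: for [i] different from [k] two
    rows coincide, and for [i = k] the matrix is unchanged. *)
Lemma det_replace_row_mul n (k : 'I_n) (S : 'M[E]_n) (x : 'rV[A]_n) :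
  \det (replace_row k (x *m emx S) (emx S)) = x 0 k * val (\det S).
Proof.
have [c cE] := det_replace_row_even k S.
have rowE i : \sum_(s : 'S_n) val (S i (s k)) * val (c s)
    = if i == k then val (\det S) else 0.
  (* For a row of [S] the determinant can be computed over the commutative ring [E]. *)
  transitivity (val (\det (replace_row k (row i S) S))).
    rewrite -det_map_mx.
    have -> : emx (replace_row k (row i S) S)
        = replace_row k (row i (emx S)) (emx S).
      by apply/matrixP=> i1 j; rewrite !mxE; case: ifP.
    by rewrite cE; apply: eq_bigr => s _; rewrite !mxE.
  case: eqVneq => [->|ik].
    congr (val (\det _)); apply/matrixP=> i1 j.
    by rewrite !mxE; case: eqP => // ->.
  rewrite (determinant_alternate ik) ?rmorph0 // => j.
  by rewrite !mxE (negPf ik) eqxx.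
rewrite cE; under eq_bigr => s _ do rewrite mxE mulr_suml.
rewrite exchange_big (bigD1 k) //= [X in _ + X]big1 => [|i /negPf ik].
  under eq_bigr => s _ do rewrite mxE -mulrA.
  by rewrite -mulr_sumr rowE eqxx addr0.
under eq_bigr => s _ do rewrite mxE -mulrA.
by rewrite -mulr_sumr rowE ik mulr0.
Qed.

Definition super_format p q (M : 'M[A]_(p + q)) :=
  [/\ mx_parity false (ulsubmx M), mx_parity true (ursubmx M),
      mx_parity true (dlsubmx M) & mx_parity false (drsubmx M)].

Lemma emx_inv n (D : 'M[E]_n) : D \in unitmx ->
  mx_inverses (emx D) (emx (invmx D)).
Proof. by move=> UD; split; rewrite -map_mxM ?mulmxV ?mulVmx // map_mx1. Qed.

(** * Schur complement and Cramer's rule for the even rows *)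

Section Cramer.
Variables (p q : nat) (M N : 'M[A]_(p + q)).
Hypotheses (Mf : super_format M) (Nf : super_format N).
Hypothesis MN : M *m N = 1%:M.

(** The relation [M10 N00 = - M11 N10] turns [S N00] into [M00 N00 + M01 N10 = 1]. Over the
    commutative ring [E] a one-sided inverse suffices. *)
Lemma super_schur :
  exists S : 'M[E]_p, exists D : 'M[E]_q,
  [/\ S \in unitmx, D \in unitmx, drsubmx M = emx D &
      ulsubmx M - ursubmx M *m mx_inv (drsubmx M) *m dlsubmx M = emx S].
Proof.
have [M00 M01 M10 M11] := Mf; have [N00 N01 N10 N11] := Nf.
have [D DE] := even_mx_lift M11; have [N11' N11E] := even_mx_lift N11.
have [N00' N00E] := even_mx_lift N00.
have [e00 e10 e11] := mulmx1_blocks MN.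
have UD : D \in unitmx.
  apply: (even_corner_unitmx (Q := N11') M10 N01).
  by rewrite -DE -N11E addrC.
have [DV VD] := emx_inv UD; have iD := mx_inv_eq DV VD.
have Sev : mx_parity false
    (ulsubmx M - ursubmx M *m mx_inv (drsubmx M) *m dlsubmx M).
  apply: mx_parityB => //; apply: (mx_parityM (b := true) (c := true)) => //.
  apply: (mx_parityM (b := true) (c := false)) => //.
  by rewrite DE iD => i j; rewrite mxE even_valP.
have [S SE] := even_mx_lift Sev; exists S, D; split=> //.
suff: S *m N00' = 1%:M by case/mulmx1_unit.
apply/matrixP=> i j; apply: val_inj.
suff /matrixP/(_ i j) : emx S *m emx N00' = 1%:M.
  by rewrite -map_mxM [in X in X -> _]mxE => ->; rewrite !mxE rmorph_nat.
rewrite -SE -N00E mulmxBl -!mulmxA.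
have -> : dlsubmx M *m ulsubmx N = - (drsubmx M *m dlsubmx N).
  by apply/eqP; rewrite -subr_eq0 opprK e10.
by rewrite DE iD !mulmxN opprK (mulmxA _ (emx D)) VD mul1mx e00.
Qed.

Lemma ulsubmx_super_invertible : mx_invertible (ulsubmx M).
Proof.
have [M00 M01 _ _] := Mf; have [N00 _ N10 _] := Nf.
have [P PE] := even_mx_lift M00; have [Q QE] := even_mx_lift N00.
have [e00 _ _] := mulmx1_blocks MN.
have /emx_inv UP : P \in unitmx.
  by apply: (even_corner_unitmx (Q := Q) M01 N10); rewrite -PE -QE.
by exists (emx (invmx P)); rewrite PE.
Qed.

Lemma drsubmx_super_invertible : mx_invertible (drsubmx M).
Proof.
have [S [D [_ /emx_inv UD DE _]]] := super_schur.
by exists (emx (invmx D)); rewrite DE.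
Qed.

(** Evenness makes the Berezinian central, which allows dividing by it on either side. *)
Lemma Ber_even_unit : Ber M \in G false /\ Ber M \is a GRing.unit.
Proof.
have [S [D [US UD DE SE]]] := super_schur.
have BE : Ber M = val (\det S * (\det D)^-1).
  by rewrite /Ber SE DE !det_map_mx rmorphM rmorphV -?unitmxE.
by rewrite BE even_valP even_val_unit unitrM unitrV -!unitmxE US UD.
Qed.

(** The lower blocks are untouched, and the replaced row of the Schur complement becomes [x0 S],
    where [x0] is the even-position part of [x]. *)
Lemma Ber_replace_row_mul (k : 'I_p) (x : 'rV[A]_(p + q)) :
  Ber (replace_row (lshift q k) (x *m M) M) = x 0 (lshift q k) * Ber M.
Proof.
have [S [D [_ UD DE SE]]] := super_schur.
have [DV VD] := emx_inv UD; have iD := mx_inv_eq DV VD.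
set M' := replace_row _ _ M.
have dl : dlsubmx M' = dlsubmx M.
  by apply/matrixP=> i j; rewrite !mxE eq_rlshift.
have dr : drsubmx M' = drsubmx M.
  by apply/matrixP=> i j; rewrite !mxE eq_rlshift.
(* The contribution of the last [q] coordinates of [x] cancels here. *)
have xM : lsubmx (x *m M) - rsubmx (x *m M) *m mx_inv (drsubmx M) *m dlsubmx M
    = lsubmx x *m emx S.
  rewrite -{1 2}[x]hsubmxK -{1 2}[M]submxK mul_row_block row_mxKl row_mxKr.
  rewrite -SE mulmxBr !mulmxDl -[_ *m drsubmx M *m mx_inv _]mulmxA DE iD DV.
  by rewrite mulmx1 !mulmxA opprD addrACA addrN addr0.
rewrite /Ber dl dr SE.
have -> : ulsubmx M' - ursubmx M' *m mx_inv (drsubmx M) *m dlsubmx M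
    = replace_row k (lsubmx x *m emx S) (emx S).
  have lE B : (ulsubmx M' - ursubmx M' *m B) =
     replace_row k (lsubmx (x *m M) - rsubmx (x *m M) *m B)
       (ulsubmx M - ursubmx M *m B).
    apply/matrixP=> i j; rewrite !mxE eq_lshift.
    by case: ifP => ik; congr (_ - _); apply: eq_bigr => l _;
      rewrite !mxE eq_lshift ik.
  by rewrite -mulmxA lE !mulmxA xM SE.
by rewrite det_replace_row_mul det_map_mx mxE mulrA.
Qed.

Lemma super_cramer (k : 'I_p) (x y : 'rV[A]_(p + q)) : x *m M = y ->
  x 0 (lshift q k) = (Ber M)^-1 * Ber (replace_row (lshift q k) y M).
Proof.
have [Bev UB] := Ber_even_unit.
by move=> <-; rewrite Ber_replace_row_mul -(sca_central scaG _ Bev) mulKr.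
Qed.

End Cramer.

(** Row [i] of [N] solves [x *m M = delta_mx 0 i]. The function [f] stands for either [Ber] or
    [BerS] of the matrix with a replaced row; centrality of [B^-1] moves it to the right. *)
Lemma mx_inv_cramer n (M N : 'M[A]_n) (k i : 'I_n) (B : A)
    (f : 'rV[A]_n -> A) :
  M *m N = 1%:M -> N *m M = 1%:M -> B \in G false ->
  (forall x y : 'rV[A]_n, x *m M = y -> x 0 k = B^-1 * f y) ->
  mx_inv M i k = f (delta_mx 0 i) / B.
Proof.
move=> MN NM Bev cramer.
have BVev : B^-1 \in G false.
  have [_ _ BV] := sca_divring scaG.
  by rewrite -[B^-1]mul1r BV // (sca_one scaG).
rewrite (mx_inv_eq MN NM) -(sca_central scaG _ BVev).
by rewrite -(cramer (row i N)) ?mxE // -row_mul NM row1.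
Qed.

End EvenMatrices.

(** * Parity reversal and the odd rows *)

Section ParityReversal.
Variables (A : nzRingType) (p q : nat).
Implicit Types M N : 'M[A]_(p + q).

Definition swap_row (x : 'rV[A]_(p + q)) : 'rV[A]_(q + p) :=
  row_mx (rsubmx x) (lsubmx x).

Lemma parity_reversedM M N :
  parity_reversed (M *m N) = parity_reversed M *m parity_reversed N.
Proof.
rewrite -{1}[M]submxK -{1}[N]submxK mulmx_block /parity_reversed mulmx_block.
rewrite block_mxKul block_mxKur block_mxKdl block_mxKdr.
by congr block_mx; rewrite addrC.
Qed.

Lemma parity_reversed1 : parity_reversed (1%:M : 'M[A]_(p + q)) = 1%:M.
Proof.
rewrite /parity_reversed !scalar_mx_block.
by rewrite block_mxKul block_mxKur block_mxKdl block_mxKdr.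
Qed.

Lemma swap_rowM (x : 'rV[A]_(p + q)) M :
  swap_row (x *m M) = swap_row x *m parity_reversed M.
Proof.
rewrite -{1}[x]hsubmxK -{1}[M]submxK mul_row_block /swap_row mul_row_block.
by rewrite row_mxKl row_mxKr; congr row_mx; rewrite addrC.
Qed.

(** Reversal moves an odd row among the first [q] rows, where the even case applies. *)
Lemma parity_reversed_replace_row (k : 'I_q) (y : 'rV[A]_(p + q)) M :
  parity_reversed (replace_row (rshift p k) y M)
    = replace_row (lshift p k) (swap_row y) (parity_reversed M).
Proof.
apply/matrixP=> i j; rewrite -(splitK i) -(splitK j) [RHS]mxE.
case: (split i) => i'; case: (split j) => j' /=;
  rewrite ?(block_mxEul, block_mxEur, block_mxEdl, block_mxEdr) ?row_mxEl
          ?row_mxEr !mxE ?eq_rlshift ?eq_lrshift ?eq_lshift ?eq_rshift //.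
Qed.

End ParityReversal.

Section OddCramer.
Variables (K : fieldType) (A : unitAlgType K) (G : bool -> {pred A}).
Variable scaG : supercommutative_algebra G.
Hypothesis nz2 : 2 != 0 :> K.

Lemma parity_reversed_super_format p q (M : 'M[A]_(p + q)) :
  super_format G M -> super_format G (parity_reversed M).
Proof.
by case=> *; split;
  rewrite ?(block_mxKul, block_mxKur, block_mxKdl, block_mxKdr).
Qed.

Variables (p q : nat) (M N : 'M[A]_(p + q)).
Hypotheses (Mf : super_format G M) (Nf : super_format G N).
Hypothesis MN : M *m N = 1%:M.

Let MpNp : parity_reversed M *m parity_reversed N = 1%:M.
Proof. by rewrite -parity_reversedM MN parity_reversed1. Qed.

Lemma BerS_even_unit : BerS M \in G false /\ BerS M \is a GRing.unit.
Proof.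
by apply: (Ber_even_unit scaG nz2 _ _ MpNp);
  apply: parity_reversed_super_format.
Qed.

Lemma super_cramer_odd (k : 'I_q) (x y : 'rV[A]_(p + q)) : x *m M = y ->
  x 0 (rshift p k) = (BerS M)^-1 * BerS (replace_row (rshift p k) y M).
Proof.
move=> xM; rewrite /BerS parity_reversed_replace_row.
have -> : x 0 (rshift p k) = swap_row x 0 (lshift p k).
  by rewrite row_mxEl mxE.
apply: (super_cramer scaG nz2 _ _ MpNp).
- exact: parity_reversed_super_format.
- exact: parity_reversed_super_format.
by rewrite -swap_rowM xM.
Qed.

End OddCramer.

(** * From operators to matrices *)

Section Coordinates.
Variables (K : fieldType) (A : unitAlgType K) (G : bool -> {pred A}).
Variables (p q : nat) (V : lmodType A) (H : bool -> {pred V}).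
Variable e : 'I_(p + q) -> V.
Hypothesis scaG : supercommutative_algebra G.
Hypotheses (gmH : graded_module G H) (eB : homogeneous_basis H e).

Lemma coord_inj (x y : 'I_(p + q) -> A) :
  \sum_i x i *: e i = \sum_i y i *: e i -> x =1 y.
Proof.
move=> xy i; have [z [_ zP]] := hb_coord eB (\sum_i x i *: e i).
have row_sum (w : 'I_(p + q) -> A) :
    \sum_i (\row_j w j) 0 i *: e i = \sum_i w i *: e i.
  by apply: eq_bigr => j _; rewrite mxE.
have /rowP/(_ i) := etrans (esym (zP (\row_j x j) (esym (row_sum x))))
  (zP (\row_j y j) (etrans xy (esym (row_sum y)))).
by rewrite !mxE.
Qed.

Lemma basis_homogeneous i : e i \in H (p <= i)%N.
Proof.
rewrite -(splitK i); case: (split i) => j /=.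
  by rewrite leqNgt ltn_ord (hb_even eB).
by rewrite leq_addr (hb_odd eB).
Qed.

(** The components of the coordinates are regrouped so that [w b] is the part of parity [b] of the
    vector. The part of the wrong parity is zero, and uniqueness of coordinates kills each component
    in it. *)
Lemma coord_parity c (x : 'I_(p + q) -> A) :
  \sum_i x i *: e i \in H c -> forall i, x i \in G (c (+) (p <= i)%N).
Proof.
have [u uG xE] := fin_all_exists2
  (fun i => direct_sum2_decomp (x i) (sca_direct scaG)).
pose w b := \sum_i u i (b (+) (p <= i)%N) *: e i.
have wH b : w b \in H b.
  have [H0 HD] := GRing.zmod_closedD (gm_zmod gmH b).
  rewrite /w; elim/big_ind: _ => // i _; rewrite -{2}[b](addbK (p <= i)%N).
  exact: (gm_scale gmH (uG i _) (basis_homogeneous i)).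
have -> : \sum_i x i *: e i = w false + w true.
  rewrite -big_split; apply: eq_bigr => i _ /=; rewrite -scalerDl xE.
  by case: (p <= i)%N => //=; rewrite addrC.
move/(direct_sum2_homogeneous (gm_zmod gmH) (gm_direct gmH) wH) => w0 i.
have /(_ i) u0 : (fun i => u i (~~ c (+) (p <= i)%N)) =1 fun=> 0.
  by apply: coord_inj; rewrite -/(w (~~ c)) w0 big1 // => j _; rewrite scale0r.
rewrite xE; move: u0 (uG i (c (+) (p <= i)%N)); rewrite addNb.
by case: (c (+) _) => /= ->; rewrite ?add0r ?addr0.
Qed.

Lemma super_format_coord (a : 'M[A]_(p + q)) :
  (forall i, \sum_j a i j *: e j \in H (p <= i)%N) -> super_format G a.
Proof.
move=> aH; have aP i j := coord_parity (aH i) j.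
have lt_p (i : 'I_p) : (p <= i)%N = false by rewrite leqNgt ltn_ord.
split=> i j; rewrite !mxE; have := aP _ _; rewrite /=.
- by move/(_ (lshift q i) (lshift q j)); rewrite /= !lt_p.
- by move/(_ (lshift q i) (rshift p j)); rewrite /= lt_p leq_addr.
- by move/(_ (rshift p i) (lshift q j)); rewrite /= lt_p leq_addr.
- by move/(_ (rshift p i) (rshift p j)); rewrite /= !leq_addr.
Qed.

(** The wrong-parity component of [v] is sent to the wrong-parity component of [F v], which is zero.
    This is what makes the inverse operator even. *)
Lemma even_operator_reflect (F : {linear V -> V}) b (v : V) :
  even_operator H F -> injective F -> F v \in H b -> v \in H b.
Proof.
move=> Fev Finj; have [u uH ->] := direct_sum2_decomp v (gm_direct gmH).
rewrite linearD => FuH.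
have /= := direct_sum2_homogeneous (gm_zmod gmH) (gm_direct gmH)
  (fun c => Fev c _ (uH c)) FuH.
rewrite -(linear0 F) => /Finj u0; have := uH b.
by case: b u0 {FuH} => /= ->; rewrite ?add0r ?addr0.
Qed.

Lemma operator_coord (F : {linear V -> V}) (a : 'M[A]_(p + q))
    (x : 'I_(p + q) -> A) :
  operator_matrix e F a ->
  F (\sum_i x i *: e i) = \sum_j (\sum_i x i * a i j) *: e j.
Proof.
move=> aE; rewrite linear_sum /=.
under eq_bigr => i _ do rewrite linearZ /= aE scaler_sumr.
rewrite exchange_big; apply: eq_bigr => j _.
by rewrite scaler_suml; apply: eq_bigr => i _; rewrite scalerA.
Qed.

Lemma operator_matrix_inverse (F : {linear V -> V}) (a : 'M[A]_(p + q)) :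
  even_operator H F -> bijective F -> operator_matrix e F a ->
  exists b, [/\ super_format G a, super_format G b,
    a *m b = 1%:M & b *m a = 1%:M].
Proof.
move=> Fev [g Fg gF] aE; have Finj := can_inj Fg.
have e_sum i : e i = \sum_j (i == j)%:R *: e j.
  rewrite (bigD1 i) //= eqxx scale1r big1 ?addr0 // => j.
  by rewrite eq_sym => /negPf ->; rewrite scale0r.
have ge_coord i : exists x : 'rV[A]_(p + q), g (e i) = \sum_j x 0 j *: e j.
  by have [x [xE _]] := hb_coord eB (g (e i)); exists x.
have [b bE] := fin_all_exists ge_coord.
pose B := \matrix_(i, j) b i 0 j.
have BE i : \sum_j B i j *: e j = g (e i).
  by rewrite bE; apply: eq_bigr => j _; rewrite mxE.
have Ba : B *m a = 1%:M.
  apply/matrixP=> i j; rewrite mxE [RHS]mxE.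
  apply: (coord_inj (x := fun j => \sum_k B i k * a k j)
    (y := fun j => (i == j)%:R)).
  by rewrite -(operator_coord _ aE) BE gF -e_sum.
(* Linearity of [g] is not at hand, so the identity is checked after applying the injective [F],
   where it reads [a B a = a]. *)
have aB : a *m B = 1%:M.
  apply/matrixP=> i j; rewrite [RHS]mxE.
  apply: (coord_inj (x := (a *m B) i) (y := fun j => (i == j)%:R)); apply: Finj.
  rewrite -e_sum (operator_coord _ aE) aE; apply: eq_bigr => k _.
  have /matrixP/(_ i k) : a *m B *m a = a by rewrite -mulmxA Ba mulmx1.
  by rewrite mxE => ->.
exists B; split=> //; apply: super_format_coord => i.
  by rewrite -aE Fev // basis_homogeneous.
by rewrite BE (even_operator_reflect Fev) // gF basis_homogeneous.
Qed.

End Coordinates.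

Theorem mainTheorem7 (R : realType) (A : unitAlgType R[i])
    (G : bool -> {pred A}) (p q : nat) (V : lmodType A)
    (H : bool -> {pred V}) (e : 'I_(p + q) -> V)
    (F : {linear V -> V}) (a : 'M[A]_(p + q)) :
  supercommutative_algebra G ->
  graded_module G H ->
  homogeneous_basis H e ->
  even_operator H F ->
  bijective F ->
  operator_matrix e F a ->
  (* all quantities below are defined *)
  [/\ mx_invertible a, mx_invertible (ulsubmx a), mx_invertible (drsubmx a),
      Ber a \is a GRing.unit & BerS a \is a GRing.unit] /\
  (forall x y : 'rV[A]_(p + q),
     F (\sum_i x 0 i *: e i) = \sum_j y 0 j *: e j ->
     (forall k : 'I_p,
        x 0 (lshift q k) = (Ber a)^-1 * Ber (replace_row (lshift q k) y a)) /\
     (forall k : 'I_q,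
        x 0 (rshift p k) = (BerS a)^-1 * BerS (replace_row (rshift p k) y a))) /\
  (forall (i : 'I_(p + q)) (j : 'I_p),
     mx_inv a i (lshift q j) = super_adj a (lshift q j) i / Ber a) /\
  (forall (i : 'I_(p + q)) (j : 'I_q),
     mx_inv a i (rshift p j) = super_adj a (rshift p j) i / BerS a).
Proof.
move=> scaG gmH eB Fev Fbij aE.
(* Characteristic zero enters here, to make odd squares vanish. *)
have nz2 : 2 != 0 :> R[i] by rewrite Num.Theory.pnatr_eq0.
have [b [af bf ab ba]] := operator_matrix_inverse scaG gmH eB Fev Fbij aE.
have [Bev UB] := Ber_even_unit scaG nz2 af bf ab.
have [Sev US] := BerS_even_unit scaG nz2 af bf ab.
split; last split.
- split=> //; first by exists b.
    exact: ulsubmx_super_invertible af bf ab.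
  exact: drsubmx_super_invertible af bf ab.
- move=> x y Fxy; suff xa : x *m a = y.
    by split=> k; [apply: super_cramer af bf ab _ _ _ xa
                  | apply: super_cramer_odd af bf ab _ _ _ xa].
  apply/rowP=> j; rewrite mxE.
  apply: (coord_inj eB (x := fun j => \sum_i x 0 i * a i j) (y := y 0)).
  by rewrite -(operator_coord _ aE).
(* An entry of [super_adj] is the value of [f] at a basis row, since [Dmx] replaces a row by
   [delta_mx]. *)
split=> i j; rewrite [super_adj _ _ _]mxE /=.
  rewrite ltn_ord (mx_inv_cramer scaG i
    (f := fun y => Ber (replace_row (lshift q j) y a)) ab ba Bev) // => x y.
  exact: super_cramer af bf ab _ _ _.
rewrite ltnNge leq_addr (mx_inv_cramer scaG i
  (f := fun y => BerS (replace_row (rshift p j) y a)) ab ba Sev) // => x y.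
exact: super_cramer_odd af bf ab _ _ _.
Qed.
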